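(* Let $G$ be a finite group, $g\in G$, $\eta$ a character of $C_G(g)$, and $m$ an integer. Then $$\nu_m(g,\eta)=\frac1{|C_G(g)|}\sum_{z\in C_G(g)}\gamma_m^z(g)\,\eta(z)=\frac1{|C_G(g)|}\sum_{z\in\underline{\mathrm{Cl}}(C_G(g))}|z^{C_G(g)}|\,\gamma_m^z(g)\,\eta(z),$$ where $\underline{\mathrm{Cl}}(C_G(g))$ is any set of representatives of the conjugacy classes of $C_G(g)$, and where, for each $z\in G$, $$\gamma_m^z=|C_G(z)|\sum_{\chi\in\mathrm{Irr}(C_G(z))}\frac{|\langle\chi,w^z_m\rangle|^2}{\chi(e)}\,\chi .$$
   Context: $C_G(g)$ is the centralizer of $g$ in $G$; $\mathrm{Irr}(H)$ is the set of irreducible complex characters of a finite group $H$; $e$ is the neutral element; $z^{H}$ is the conjugacy class of $z$ in $H$. For $g,z\in G$ put $G_m(g,z):=\{x\in G\mid x^m=(gx)^m=z\}$. For $z\in G$ the function $\gamma_m^z\colon C_G(z)\to\mathbb C$ is defined by $\gamma_m^z(g)=|G_m(g,z)|$; it is a class function on $C_G(z)$. The class function $w_m^z\colon C_G(z)\to\mathbb C$ is defined by $w_m^z(x)=1$ if $x^m=z$ and $w_m^z(x)=0$ otherwise. For class functions $f,f'$ on a finite group $H$, $\langle f,f'\rangle=\frac1{|H|}\sum_{x\in H}f(x)\overline{f'(x)}$. Modules over the Drinfeld double $D(G)$ (over $\mathbb C$) are described by pairs $(g,\eta)$ with $g\in G$ and $\eta$ a character of $C_G(g)$, and $\nu_m(g,\eta)$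 denotes the $m$-th (higher) Frobenius-Schur indicator of the $D(G)$-module associated to $(g,\eta)$. By a known result of Kashina-Sommerhäuser-Zhu, which may be taken as the definition, $\nu_m(g,\eta)=\frac1{|C_G(g)|}\sum_{x\in G,\ x^m=(gx)^m}\eta(x^m)$ (the elements $x^m$ occurring in the sum lie in $C_G(g)$). *)

(* Defs.v *)
From mathcomp Require Import all_boot all_order all_fingroup all_algebra.
From mathcomp Require Import all_solvable all_field all_character.

Set Implicit Arguments.
Unset Strict Implicit.
Unset Printing Implicit Defensive.

Import GroupScope GRing.Theory.
Local Open Scope ring_scope.

Section Defs.

Variable gT : finGroupType.
Implicit Types (G : {group gT}) (g x y z : gT) (m : int).

(* Fingroup powers have exponents in nat; Negz n stands for - (n + 1). *)
Definition zexpg x m : gT :=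
  match m with
  | Posz n => (x ^+ n)%g
  | Negz n => (x ^- n.+1)%g
  end.

Lemma zexpgJ x y m : zexpg (x ^ y)%g m = (zexpg x m ^ y)%g.
Proof. by case: m => n; rewrite /zexpg ?conjVg conjXg. Qed.

Definition Gm_set G m g z : {set gT} :=
  [set x in G | (zexpg x m == z) && (zexpg (g * x)%g m == z)].

Lemma card_Gm_setJ G m g y z :
  y \in 'C_G[z] -> #|Gm_set G m (g ^ y)%g z| = #|Gm_set G m g z|.
Proof.
case/setIP=> Gy /cent1P czy; have zy: (z ^ y)%g = z.
  by apply/conjg_fixP/commgP.
rewrite -(cardJg (Gm_set G m g z) y); congr #|pred_of_set _|.
apply/setP=> x; rewrite mem_conjg !inE groupJr ?groupV //.
rewrite -(inj_eq (conjg_inj y) (zexpg (x ^ _) _)) -zexpgJ zy conjgKV.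
by rewrite -(inj_eq (conjg_inj y) (zexpg (g * _) _)) -zexpgJ zy conjMg conjgKV.
Qed.

(* Class functions on 'C_G[z] are extended by 0 outside it, as 'CF requires. *)
Fact gamma_subproof G m z :
  is_class_fun <<'C_G[z]>>
    [ffun g => if g \in 'C_G[z] then #|Gm_set G m g z|%:R else 0].
Proof.
rewrite genGid; apply: intro_class_fun => [g y Cg Cy | g /negbTE-> //].
by rewrite groupJr // card_Gm_setJ.
Qed.
Definition gamma G m z : 'CF('C_G[z]) := Cfun 0 (gamma_subproof G m z).

Fact w_subproof G m z :
  is_class_fun <<'C_G[z]>>
    [ffun x => ((x \in 'C_G[z]) && (zexpg x m == z))%:R].
Proof.
rewrite genGid; apply: intro_class_fun => [x y Cx Cy | x /negbTE-> //].
rewrite groupJr // zexpgJ; have /setIP[_ /cent1P czy] := Cy.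
by rewrite -(inj_eq (conjg_inj y) (zexpg x m)) (_ : z ^ y = z)%g //;
   apply/conjg_fixP/commgP.
Qed.
Definition w G m z : 'CF('C_G[z]) := Cfun 0 (w_subproof G m z).

Lemma gammaE G m z g :
  g \in 'C_G[z] -> gamma G m z g = #|Gm_set G m g z|%:R.
Proof. by move=> Cg; rewrite cfunE Cg. Qed.

Lemma wE G m z x : x \in 'C_G[z] -> w G m z x = (zexpg x m == z)%:R.
Proof. by move=> Cx; rewrite cfunE Cx. Qed.

(* The m-th Frobenius-Schur indicator of the module over the Drinfeld double
   D(G) attached to (g, eta), given by the Kashina-Sommerhaeuser-Zhu formula. *)
Definition nu G m g (eta : 'CF('C_G[g])) : algC :=
  #|'C_G[g]|%:R^-1 *
    \sum_(x in G | zexpg x m == zexpg (g * x)%g m) eta (zexpg x m).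

End Defs.

(* Main.v *)
(* Grouping the x with x^m = (gx)^m by the value z = x^m turns the sum defining
   nu into a sum over z, and every such z commutes with x and gx, hence with g.
   On C_G(z), gamma_m^z is the autocorrelation g |-> \sum_x w(gx) conj(w(x)) of
   the indicator w of the m-th roots of z, all of which lie in C_G(z); expanding
   w in irreducible characters, generalized orthogonality kills the cross terms
   and leaves the squared moduli of the coefficients of w. *)

Require Import Defs.
From mathcomp Require Import all_boot all_order all_fingroup all_algebra.
From mathcomp Require Import all_solvable all_field all_character.

Set Implicit Arguments.
Unset Strict Implicit.
Unset Printing Implicit Defensive.

Import GroupScope GRing.Theory.
Local Open Scope ring_scope.

Lemma cfun_autocorrelation (gT : finGroupType) (H : {group gT})
    (phi : 'CF(H)) (y : gT) :
  \sum_(x in H) phi (x * y)%g * (phi x)^* =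
    #|H|%:R * \sum_(i : Iirr H) `|'[phi, 'chi_i]| ^+ 2 / 'chi_i 1%g * 'chi_i y.
Proof.
rewrite mulr_sumr {1 2}(cfun_sum_cfdot phi).
under eq_bigr => x _.
  rewrite !sum_cfunE rmorph_sum big_distrlr /=.
  under eq_bigr => i _ do
    under eq_bigr => j _ do rewrite !cfunE rmorphM mulrACA /= -irr_inv.
  over.
rewrite exchange_big; apply: eq_bigr => i _; rewrite exchange_big /=.
(* Conjugation of ['chi_j x] has become inversion of [x], so the inner sum is a convolution of two
   irreducible characters. *)
have sum_irr j : \sum_(x in H) 'chi_i (x * y)%g * 'chi_j x^-1%g =
    #|H|%:R * ((i == j)%:R * ('chi_i y / 'chi_i 1%g)).
  by rewrite -generalized_orthogonality_relation mulVKf ?neq0CG.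
under eq_bigr => j _ do rewrite -mulr_sumr sum_irr.
rewrite (bigD1 i) //= big1 => [|j /negPf ne_ji]; last first.
  by rewrite eq_sym ne_ji mul0r !mulr0.
by rewrite addr0 eqxx mul1r -Num.Theory.normCK mulrCA -mulrA ['chi_i y * _]mulrC.
Qed.

Section Gamma.

Variables (gT : finGroupType) (G : {group gT}) (m : int).
Implicit Types (g x y z : gT).

Lemma zexpg_cent x : zexpg x m \in 'C[x].
Proof. by case: m => n; rewrite /zexpg ?groupV groupX ?cent1id.
Qed.

Lemma zexpg_in x : x \in G -> zexpg x m \in G.
Proof. by case: m => n Gx; rewrite /zexpg ?groupV groupX. Qed.

Lemma subcent1C g z : g \in G -> z \in 'C_G[g] -> g \in 'C_G[z].
Proof. by move=> Gg /setIP[_ Cz]; rewrite inE Gg cent1C. Qed.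

(** Here [g] is fixed and [z] moves, so [gamma G m z] being a class function does not help. Since
    [y] commutes with [g], conjugation by [y] carries [Gm_set G m g z] onto
    [Gm_set G m g (z ^ y)]. *)
Lemma gammaJ g y z : g \in G -> z \in 'C_G[g] -> y \in 'C_G[g] ->
  gamma G m (z ^ y)%g g = gamma G m z g.
Proof.
move=> Gg Cz Cy; have Czy := groupJ Cz Cy.
rewrite (gammaE _ (subcent1C Gg Czy)) (gammaE _ (subcent1C Gg Cz)).
have [Gy /cent1P cgy] := setIP Cy.
have gy: (g ^ y)%g = g by apply/conjg_fixP/commgP; apply/commute_sym.
congr (_%:R); rewrite -(cardJg (Gm_set G m g z) y).
congr #|pred_of_set _|; apply/setP=> x; rewrite mem_conjg !inE groupJr ?groupV //.
rewrite -(inj_eq (conjg_inj y) (zexpg (x ^ _) _)) -zexpgJ conjgKV.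
by rewrite -(inj_eq (conjg_inj y) (zexpg (g * (_ ^ _)) _)) -zexpgJ conjMg conjgKV gy.
Qed.

Lemma nu_sum_gamma g (eta : 'CF('C_G[g])) : g \in G ->
  nu m eta = #|'C_G[g]|%:R^-1 * \sum_(z in 'C_G[g]) gamma G m z g * eta z.
Proof.
move=> Gg; congr (_ * _).
rewrite (partition_big (fun x => zexpg x m) (mem 'C_G[g])) /= => [|x]; last first.
  case/andP=> Gx /eqP eq_xm; rewrite inE zexpg_in //= cent1C.
  (* Both [x] and [g * x] commute with their common [m]-th power; cancelling [x] leaves [g] in its
     centralizer. *)
  have Cx: x \in 'C[zexpg x m] by rewrite cent1C zexpg_cent.
  by rewrite -(groupMr _ Cx) cent1C {1}eq_xm zexpg_cent.
apply: eq_bigr => z Cz; rewrite (gammaE _ (subcent1C Gg Cz)).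
rewrite mulr_natl -sumr_const.
apply: eq_big => [x|x /andP[_ /eqP-> //]].
rewrite inE -andbA; congr (_ && _); rewrite andbC.
by apply: andb_id2l => /eqP->; rewrite eq_sym.
Qed.

Lemma gamma_irr_expansion z :
  gamma G m z =
    #|'C_G[z]|%:R *:
      \sum_(i : Iirr 'C_G[z])
        (`|'['chi_i, w G m z]| ^+ 2 / 'chi_i 1%g) *: 'chi_i.
Proof.
apply/cfun_inP=> g Cg; rewrite gammaE // cfunE sum_cfunE.
(* Swapping the arguments of the inner product conjugates it, which leaves the modulus unchanged. *)
under eq_bigr do rewrite cfunE cfdotC Num.Theory.norm_conjC.
rewrite -cfun_autocorrelation -sum1_card natr_sum big_mkcond /=.
rewrite [RHS]big_mkcond; apply: eq_bigr => x _.
rewrite [x \in Gm_set _ _ _ _]inE.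
(* An [m]-th root of [z] commutes with [z], so elements outside ['C_G[z]] contribute 0 on both
   sides. *)
have [Cx | nCx] := boolP (x \in 'C_G[z]); last first.
  case: ifP => // /and3P[Gx /eqP xm _]; case/negP: nCx.
  by rewrite inE Gx cent1C -xm zexpg_cent.
(* The autocorrelation multiplies by [g] on the right, [Gm_set] on the left; the two products are
   conjugate and [w] is a class function. *)
have ->: (x * g = (g * x) ^ g)%g by rewrite conjgE mulgA mulKg.
rewrite cfunJ // !wE ?groupM // rmorph_nat -natrM mulnb andbC.
by have /setIP[-> _] := Cx; do 2!case: (_ == z).
Qed.

End Gamma.

(** A transversal meets each class exactly once, so [pblock] reindexes the sum over classes by
    [Cl]. *)
Lemma sum_class_transversal (gT : finGroupType) (H : {group gT}) (Cl : {set gT})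
    (R : nzRingType) (F : gT -> R) :
    is_transversal Cl (classes H) H ->
    {in H &, forall z y, F (z ^ y)%g = F z} ->
  \sum_(z in H) F z = \sum_(z in Cl) #|z ^: H|%:R * F z.
Proof.
move=> trCl FJ; rewrite (sum_by_classes FJ) -{1}(pblock_transversal trCl).
rewrite big_imset /=; last exact: pblock_inj trCl.
apply: eq_bigr => z Clz; have Hz := subsetP (transversal_sub trCl) z Clz.
have /and3P[_ tiH _] := classes_partition H.
rewrite (def_pblock tiH (mem_classes Hz) (class_refl H z)).
(* The sum over classes evaluates [F] at the canonical [repr], a conjugate of the chosen [z]. *)
by have [y Hy ->] := repr_class H z; rewrite FJ.
Qed.

Theorem corollary4p2 (gT : finGroupType) (G : {group gT}) (g : gT)
    (hg : g \in G) (eta : 'CF('C_G[g])) (heta : eta \is a character)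
    (m : int) :
  [/\ nu m eta =
        #|'C_G[g]|%:R^-1 * \sum_(z in 'C_G[g]) gamma G m z g * eta z,
      forall Cl : {set gT},
        is_transversal Cl (classes 'C_G[g]) 'C_G[g] ->
        nu m eta =
          #|'C_G[g]|%:R^-1 *
            \sum_(z in Cl) #|z ^: 'C_G[g]|%:R * gamma G m z g * eta z
    & forall z : gT, z \in G ->
        gamma G m z =
          #|'C_G[z]|%:R *:
            \sum_(i : Iirr 'C_G[z])
              (`|'['chi_i, w G m z]| ^+ 2 / 'chi_i 1%g) *: 'chi_i].
Proof.
have nuE := nu_sum_gamma m eta hg.
split=> // [Cl trCl | z _]; last exact: gamma_irr_expansion.
rewrite nuE; under [in RHS]eq_bigr do rewrite -mulrA.
congr (_ * _); apply: sum_class_transversal => // z y Cz Cy.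
by rewrite gammaJ // cfunJ.
Qed.
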